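(* Let $\pi$ be a probability distribution supported on a countably infinite set of atoms (with masses $\pi_x>0$ at the atoms $x$), let $\{\xi_n:n\ge 1\}$ be a sequence of i.i.d. random variables with common distribution $\pi$, and let $R_n:=\#\{\xi_k:1\le k\le n\}$ be the number of distinct values among $\xi_1,\dots,\xi_n$. Then $$\lim_{n\to\infty}\frac{R_n}{\mathbb{E}R_n}=1\quad\text{almost surely},$$ and for every $n\ge 1$ $$\mathbb{E}R_n=\sum_x\left[1-(1-\pi_x)^n\right],\qquad \mathrm{Var}(R_n)\le \mathbb{E}R_n .$$
   Context: $\#A$ denotes the cardinality of a set $A$; the sum over $x$ runs over all atoms of $\pi$. *)

(* Defs.v *)
From HB Require Import structures.
From mathcomp Require Import all_boot all_order all_algebra finmap.
From mathcomp Require Import all_classical all_reals all_analysis.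

Set Implicit Arguments.
Unset Strict Implicit.
Unset Printing Implicit Defensive.

Import Order.TTheory GRing.Theory Num.Theory.
Import numFieldNormedType.Exports.

Local Open Scope classical_set_scope.
Local Open Scope ring_scope.

(* [pi] is a discrete probability distribution whose set of atoms is [A].  No
   assumption is made on the sigma-algebra of [E] beyond the measurability of
   the atoms, so [E] may be a countable type with all its subsets as well as,
   for instance, the Borel real line. *)
Record supported_on_atoms (R : realType) (d : measure_display)
    (E : measurableType d) (pi : probability E R) (A : set E) : Prop :=
  SupportedOnAtoms {
    atom_measurable : forall x, A x -> measurable [set x] ;
    atom_mass_gt0 : forall x, A x -> (0 < pi [set x])%E ;
    atoms_full_mass : pi A = 1%E }.

Definition mutually_independent (R : realType) (d d' : measure_display)
    (T : measurableType d) (E : measurableType d') (P : probability T R)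
    (I : choiceType) (X : I -> {RV P >-> E}) : Prop :=
  forall (J : {fset I}) (B : I -> set E),
    (forall i, i \in J -> measurable (B i)) ->
    P (\bigcap_(i in [set` J]) X i @^-1` B i) =
    (\prod_(i <- J) P (X i @^-1` B i))%E.

Definition iid (R : realType) (d d' : measure_display)
    (T : measurableType d) (E : measurableType d') (P : probability T R)
    (I : choiceType) (X : I -> {RV P >-> E}) (pi : probability E R) : Prop :=
  mutually_independent X /\
  forall i B, measurable B -> distribution P (X i) B = pi B.

(* Sequences are indexed from 0: [xi k] is the (k+1)-st variable, and the first
   [n] variables are the [xi k] with [k < n].  With no assumption on the
   sigma-algebra of [E] this is a measurable function only up to a null set
   (the event that some variable avoids the atoms). *)
Definition num_distinct (R : realType) (T : Type) (E : choiceType)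
    (xi : nat -> T -> E) (n : nat) (w : T) : R :=
  #|` fset_set [set xi k w | k in `I_n] |%:R.

(* Main.v *)
Require Import Defs.
From HB Require Import structures.
From mathcomp Require Import all_boot all_order all_algebra finmap.
From mathcomp Require Import all_classical all_reals all_analysis.
From mathcomp Require Import measurable_realfun lra ring.

Set Implicit Arguments.
Unset Strict Implicit.
Unset Printing Implicit Defensive.

Import Order.TTheory GRing.Theory Num.Theory.
Import numFieldNormedType.Exports.

Local Open Scope classical_set_scope.
Local Open Scope ring_scope.

(** Write [hit n x] for the event that the value [x] is among the first [n]
    variables.  Almost surely all variables are atoms, and then the number of
    distinct values is the sum over the atoms of the indicators of [hit n x].
    The complement of [hit n x] says that [n] independent variables all avoid
    [x], so it has probability [(1 - pi x)^n]; summing over the atoms gives the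
    formula for the mean.  The complements of [hit n x] and [hit n y] occur
    together with probability [(1 - pi x - pi y)^n], which is at most
    [((1 - pi x) (1 - pi y))^n]: distinct atoms are negatively correlated
    ([hit_negatively_correlated]).  Expanding the square, the off-diagonal terms
    add up to at most the square of the mean and the diagonal ones are the mean,
    hence the variance is at most the mean ([variance_num_distinct_le]).

    The law of large numbers is then one for monotone processes whose mean
    [m n] bounds their variance and grows from 0 to infinity by increments of
    at most 1 ([strong_law_of_variance_le_mean]).  At the first time [N k] at
    which [m] reaches [(k + 1)^2], the mean square of the relative error is at
    most [1 / (k + 1)^2], which is summable; so the relative error is almost
    surely square summable along the times [N k] and tends to 0.  Since
    [m (N (k + 1)) / m (N k)] tends to 1, monotonicity carries the convergence
    from the times [N k] to all times ([cvg_ratio_of_square_passage]).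

    The number of distinct values need not be measurable on the null event that
    some variable is not an atom.  Its integrals are therefore moved to a
    measurable function that agrees with it off that event
    ([ge0_eq_integral_null]). *)

(** * Integrals of functions that agree off a null set *)

Section null_sets.
Local Open Scope ereal_scope.
Context d (T : measurableType d) (R : realType).
Variable mu : {measure set T -> \bar R}.
Import HBNNSimple.

(** Neither function is assumed measurable: the integral of a nonnegative
    function is the supremum of the integrals of the simple functions below it,
    and cutting such a simple function to the complement of [N] keeps its
    integral and puts it below [g] everywhere. *)
Lemma ge0_le_integral_null (N : set T) (f g : T -> \bar R) :
  measurable N -> mu N = 0 ->
  (forall x, 0 <= f x) -> (forall x, 0 <= g x) ->
  (forall x, ~ N x -> f x <= g x) ->
  \int[mu]_x f x <= \int[mu]_x g x.
Proof.
move=> mN muN f0 g0 fg; have mNc := measurableC mN.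
rewrite ge0_integralTE//; apply: ge_ereal_sup => _ [h hf <-].
have -> : sintegral mu h = \int[mu]_x (h x)%:E.
  by rewrite integral_nnsfun// patch_setT.
have mh : measurable_fun [set: T] (EFin \o h) by exact/measurable_EFinP.
rewrite (@ge0_negligible_integral _ _ _ mu setT N)//; last first.
  by move=> x _; rewrite lee_fin.
rewrite setTD integral_nnsfun// mrestrict ge0_integralTE//.
apply: ereal_sup_ubound; exists (proj_nnsfun h mNc) => // x.
have -> : proj_nnsfun h mNc x = (h \_ (~` N)) x by rewrite mrestrict.
rewrite patchE; case: ifPn => [/set_mem Nx|_]; last exact: g0.
by rewrite (le_trans (hf x))// fg.
Qed.

Lemma ge0_eq_integral_null (N : set T) (f g : T -> \bar R) :
  measurable N -> mu N = 0 ->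
  (forall x, 0 <= f x) -> (forall x, 0 <= g x) ->
  (forall x, ~ N x -> f x = g x) ->
  \int[mu]_x f x = \int[mu]_x g x.
Proof.
by move=> mN muN f0 g0 fg; apply/eqP; rewrite eq_le; apply/andP; split;
  apply: (ge0_le_integral_null mN) => // x /fg ->.
Qed.

End null_sets.

Section null_sets_probability.
Local Open Scope ereal_scope.
Context d (T : measurableType d) (R : realType) (P : probability T R).
Variables (N : set T) (X Y : T -> R).
Hypotheses (mN : measurable N) (PN : P N = 0).
Hypotheses (X0 : forall x, (0 <= X x)%R) (Y0 : forall x, (0 <= Y x)%R).
Hypothesis XY : forall x, ~ N x -> X x = Y x.

Lemma ge0_eq_expectation_null : 'E_P[X] = 'E_P[Y].
Proof.
rewrite unlock; apply: (ge0_eq_integral_null mN) => //= x; rewrite ?lee_fin//.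
by move/XY ->.
Qed.

Lemma ge0_eq_variance_null : 'V_P[X] = 'V_P[Y].
Proof.
rewrite /variance unlock -ge0_eq_expectation_null unlock.
apply: (ge0_eq_integral_null mN) => // x.
- exact: sqr_ge0.
- exact: sqr_ge0.
- by move=> Nx; rewrite fctE /= XY.
Qed.

End null_sets_probability.

(** * First passages of a slowly increasing sequence *)

Section first_passage.
Context (R : realType) (m : R^nat).
Hypothesis m0 : m 0%N = 0.
Hypothesis m_step : forall n, m n.+1 <= m n + 1.
Hypothesis m_mono : nondecreasing_seq m.
Hypothesis m_infty : m n @[n --> \oo] --> +oo.

Lemma reaches (c : R) : exists n, c <= m n.
Proof.
by have /cvgryPge/(_ c) [n _ nc] := m_infty; exists n; exact: nc n (leqnn n).
Qed.

Definition first_passage (c : R) : nat := ex_minn (reaches c).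

Lemma le_first_passage c : c <= m (first_passage c).
Proof. by rewrite /first_passage; case: ex_minnP. Qed.

Lemma first_passage_le c n : c <= m n -> (first_passage c <= n)%N.
Proof. by rewrite /first_passage; case: ex_minnP => k _ /[apply]. Qed.

Lemma lt_first_passage c n : m n < c -> (n < first_passage c)%N.
Proof.
move=> nc; rewrite ltnNge; apply/negP => /m_mono.
move/(le_trans (le_first_passage c)).
by rewrite leNgt nc.
Qed.

Lemma first_passage_overshoot c : 0 <= c -> m (first_passage c) <= c + 1.
Proof.
move=> c0; case E : (first_passage c) => [|n]; first by rewrite m0 addr_ge0.
apply: le_trans (m_step n) _; rewrite lerD2r ltW// ltNge; apply/negP.
by move/first_passage_le; rewrite E ltnn.
Qed.

(** Squares serve because they are sparse enough for their inverses to be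
    summable, and dense enough for consecutive ones to have ratio tending to
    1. *)
Definition square_passage k : nat := first_passage (k.+1%:R ^+ 2).

Lemma square_passage_gt0 k : 0 < m (square_passage k).
Proof. by apply: lt_le_trans (le_first_passage _); rewrite exprn_gt0. Qed.

(** Between two consecutive passages, [x n / m n] lies between the ratios at
    these passages up to the factor [c k], which bounds the growth of [m] from
    one passage to the next. *)
Lemma cvg_ratio_of_square_passage (x : R^nat) :
  (forall n, 0 <= x n) -> nondecreasing_seq x ->
  x (square_passage k) / m (square_passage k) @[k --> \oo] --> (1 : R) ->
  x n / m n @[n --> \oo] --> (1 : R).
Proof.
move=> x0 x_mono rl.
pose N := square_passage.
(* [c k] is [((k + 2)^2 + 1) / (k + 1)^2], where the numerator bounds
   [m (N k.+1)] and the denominator is at most [m (N k)]. *)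
pose c k : R := (1 + (k.+1%:R)^-1) ^+ 2 + (k.+1%:R)^-1 ^+ 2.
have c1 k : 1 <= c k.
  have h0 : 0 <= (k.+1%:R)^-1 :> R by [].
  by rewrite /c; move: (k.+1%:R^-1) h0 => h h0; nra.
have cl : c k @[k --> \oo] --> (1 : R).
  have hl : (k.+1%:R : R)^-1 @[k --> \oo] --> (0 : R) by exact: cvg_harmonic.
  have -> : (1 : R) = (1 + 0) * (1 + 0) + 0 * 0 by ring.
  rewrite /c; under eq_fun do rewrite !expr2.
  by apply: cvgD; [apply: cvgM; apply: cvgD => //; exact: cvg_cst|exact: cvgM].
have mN k : m (N k.+1) <= c k * m (N k).
  have kp : 0 < k.+1%:R :> R by rewrite ltr0n.
  apply: (@le_trans _ _ (c k * k.+1%:R ^+ 2)); last first.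
    by rewrite ler_wpM2l ?le_first_passage// (le_trans _ (c1 k)).
  have -> : c k * k.+1%:R ^+ 2 = k.+2%:R ^+ 2 + 1.
    rewrite /c -[k.+2%:R]natr1; field.
    by rewrite gt_eqF.
  by rewrite first_passage_overshoot ?sqr_ge0.
(* The index of the last passage up to time [n]: the predecessor accounts for
   [square_passage k] being the passage at the square of [k.+1]. *)
pose s n := Num.truncn (Num.sqrt (m n)).
pose K n := (s n).-1.
have sl j : \forall n \near \oo, (j <= s n)%N.
  have /cvgryPge/(_ (j%:R ^+ 2)) := m_infty; apply: filterS => n jm.
  rewrite /s truncn_ge_nat ?sqrtr_ge0// -[leLHS]ger0_norm//.
  by rewrite -sqrtr_sqr ler_wsqrtr.
have Kl : K n @[n --> \oo] --> \oo.
  apply/cvgnyPge => j; have := sl j.+1; apply: filterS => n js.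
  by rewrite /K -ltnS prednK//; exact: leq_trans js.
have Kbound : \forall n \near \oo, (N (K n) <= n)%N && (n <= N (K n).+1)%N.
  have := sl 1%N; apply: filterS => n s0.
  have m_ge0 : 0 <= m n by rewrite -m0; exact: m_mono.
  have /andP[sm ms] := truncn_itv (sqrtr_ge0 (m n)).
  rewrite -/(s n) in sm ms; rewrite /N /square_passage /K prednK//.
  apply/andP; split.
    apply: first_passage_le.
    by rewrite -[leRHS]sqr_sqrtr// ler_sqr ?nnegrE ?sqrtr_ge0.
  apply/ltnW/lt_first_passage; rewrite -[ltLHS]sqr_sqrtr//.
  by rewrite ltr_sqr ?nnegrE ?sqrtr_ge0.
apply: (@squeeze_cvgr _ _ _ _ (fun n => x (N (K n)) / m (N (K n)) / c (K n))
  (fun n => x (N (K n).+1) / m (N (K n).+1) * c (K n))).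
- near=> n.
  have /andP[Kn nK] : (N (K n) <= n)%N && (n <= N (K n).+1)%N by near: n.
  have mN0 := square_passage_gt0 (K n); have mN1 := square_passage_gt0 (K n).+1.
  have mn0 : 0 < m n by apply: lt_le_trans (m_mono Kn).
  have c0 : 0 < c (K n) by apply: lt_le_trans (c1 _).
  apply/andP; split.
    rewrite -mulrA -invfM; apply: ler_pM => //.
    - by rewrite invr_ge0 mulr_ge0// ltW.
    - exact: x_mono.
    - rewrite lef_pV2 ?posrE ?mulr_gt0// mulrC.
      by apply: le_trans (mN _); exact: m_mono.
  rewrite -mulrA; apply: ler_pM => //.
  - by rewrite invr_ge0 ltW.
  - exact: x_mono.
  - rewrite mulrC ler_pdivlMr// ler_pdivrMl// mulrC.
    by apply: le_trans (mN _) _; rewrite ler_wpM2l ?(ltW c0)//; exact: m_mono.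
- rewrite -[1 in X in _ --> X](divr1 1); apply: cvgM.
    exact: (cvg_comp _ _ Kl rl).
  by apply: cvgV => //; exact: (cvg_comp _ _ Kl cl).
- rewrite -[1 in X in _ --> X](mulr1 1); apply: cvgM.
    have rS : x (N k.+1) / m (N k.+1) @[k --> \oo] --> (1 : R).
      by rewrite (cvg_shiftS (fun k => x (N k) / m (N k))).
    exact: (cvg_comp _ _ Kl rS).
  exact: (cvg_comp _ _ Kl cl).
Unshelve. all: end_near.
Qed.
End first_passage.

(** * A strong law for monotone processes *)

(** The inverse of [(n + 2)^2] is below [1 / (n + 1) - 1 / (n + 2)], so the sum
    telescopes. *)
Lemma sum_inv_square_le (R : realFieldType) n :
  \sum_(0 <= k < n.+1) (k.+1%:R ^+ 2)^-1 <= 2 - n.+1%:R^-1 :> R.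
Proof.
elim: n => [|n ih].
  by rewrite big_nat1 expr1n invr1; lra.
rewrite big_nat_recr//=; apply: le_trans (lerD ih (lexx _)) _.
have x0 : 0 < n.+1%:R :> R by rewrite ltr0n.
rewrite -[n.+2%:R]natr1; move: n.+1%:R x0 => x x0.
rewrite -subr_ge0.
have -> : 2 - (x + 1)^-1 - (2 - x^-1 + ((x + 1) ^+ 2)^-1) =
    (x * (x + 1) ^+ 2)^-1.
  by field; rewrite !gt_eqF// ltr_wpDr.
by rewrite invr_ge0 mulr_ge0 ?sqr_ge0// ltW.
Qed.

Section strong_law.
Local Open Scope ereal_scope.
Context d (T : measurableType d) (R : realType) (P : probability T R).

(** The sum of the [Z k] has a finite expectation, so it is almost surely
    finite and its terms tend to 0. *)
Lemma cvg0_of_summable_expectations (Z : nat -> T -> R) :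
  (forall k, measurable_fun [set: T] (Z k)) ->
  (forall k w, (0 <= Z k w)%R) ->
  \sum_(k <oo) 'E_P[Z k] < +oo ->
  {ae P, forall w, Z k w @[k --> \oo] --> (0 : R)%R}.
Proof.
move=> mZ Z0 sZ.
pose S w := \sum_(k <oo) (Z k w)%:E.
have S0 w : 0 <= S w by apply: nneseries_ge0 => k _ _; rewrite lee_fin.
have mS : measurable_fun [set: T] S.
  apply: ge0_emeasurable_sum => [k w _ _|k _]; first by rewrite lee_fin.
  exact/measurable_EFinP.
have iS : P.-integrable [set: T] S.
  apply/integrableP; split => //.
  under eq_integral do rewrite gee0_abs//.
  rewrite integral_nneseries//.
  - apply: le_lt_trans sZ.
    by rewrite (eq_eseriesr (g := fun k => 'E_P[Z k]))// => k _; rewrite unlock.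
  - by move=> k; exact/measurable_EFinP.
  - by move=> k w _; rewrite lee_fin.
have := integrable_ae measurableT iS; apply: filterS => w /(_ Logic.I) Sw.
have Z0w k : 0 <= (Z k w)%:E by rewrite lee_fin.
have Soo : S w < +oo by rewrite -ge0_fin_numE.
have tail0 := nneseries_tail_cvg Soo (fun k _ => Z0w k).
suff : (Z k w)%:E @[k --> \oo] --> 0 by move/fine_cvg.
apply: (squeeze_cvge _ (cvg_cst 0) tail0).
apply: nearW => k; rewrite Z0w/=.
rewrite (nneseries_split k 1)//.
by rewrite addn1 big_nat1 leeDl// nneseries_ge0.
Qed.

Section monotone_process.
Variables (X : nat -> T -> R) (m : R^nat).
Hypothesis mX : forall n, measurable_fun [set: T] (X n).
Hypothesis X_ge0 : forall n w, (0 <= X n w)%R.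
Hypothesis X_mono : forall w, nondecreasing_seq (X ^~ w).
Hypothesis EX : forall n, 'E_P[X n] = (m n)%:E.
Hypothesis VX : forall n, 'V_P[X n] <= 'E_P[X n].
Hypothesis m0 : m 0%N = 0%R.
Hypothesis m_step : forall n, (m n.+1 <= m n + 1)%R.
Hypothesis m_infty : m n @[n --> \oo] --> +oo%R.

(** The left-hand side is the variance of [X n] divided by [m n ^+ 2]. *)
Lemma expectation_relative_error_le n : (0 < m n)%R ->
  'E_P[fun w => ((X n w / m n - 1) ^+ 2)%R] <= ((m n)^-1)%:E.
Proof.
move=> mn0.
have -> : (fun w => ((X n w / m n - 1) ^+ 2)%R) =
    (fun w => ((m n ^+ 2)^-1 * ((X n w - m n) ^+ 2))%R).
  by apply/funext => w; field; rewrite gt_eqF.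
have := VX n; rewrite /variance [in X in X -> _]unlock EX /= unlock => Vm.
under eq_integral do rewrite EFinM.
rewrite ge0_integralZl_EFin//; first last.
- by rewrite invr_ge0 sqr_ge0.
- apply/measurable_EFinP; apply: measurable_funX; exact: measurable_funB.
- by move=> w _; rewrite lee_fin sqr_ge0.
have -> : ((m n)^-1)%:E = ((m n ^+ 2)^-1)%:E * (m n)%:E.
  by rewrite -EFinM; congr EFin; field; rewrite gt_eqF.
by rewrite lee_wpmul2l// lee_fin invr_ge0 sqr_ge0.
Qed.

Lemma strong_law_of_variance_le_mean :
  {ae P, forall w, X n w / m n @[n --> \oo] --> (1 : R)}%R.
Proof.
have m_mono : nondecreasing_seq m.
  move=> i j ij; rewrite -lee_fin -!EX expectation_le//.
  by apply: aeW => w; exact: X_mono.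
pose N := square_passage m_infty.
pose Z k w := ((X (N k) w / m (N k) - 1) ^+ 2)%R.
have mN0 k : (0 < m (N k))%R by exact: square_passage_gt0.
have Z0 k w : (0 <= Z k w)%R by exact: sqr_ge0.
have EZ k : 'E_P[Z k] <= ((k.+1%:R ^+ 2)^-1)%:E.
  apply: le_trans (expectation_relative_error_le (mN0 k)) _.
  rewrite lee_fin lef_pV2 ?posrE ?exprn_gt0//.
  exact: le_first_passage.
have sZ : \sum_(k <oo) 'E_P[Z k] < +oo.
  apply: (@le_lt_trans _ _ 2%:E); last exact: ltry.
  apply: lime_le.
    by apply: is_cvg_nneseries => k _ _; exact: expectation_ge0.
  apply: nearW => n.
  apply: (@le_trans _ _ (\sum_(0 <= k < n.+1) ((k.+1%:R ^+ 2)^-1)%:E)).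
    rewrite big_nat_recr//= -[leLHS]adde0 leeD ?lee_fin ?invr_ge0//.
    by apply: lee_sum => k _; exact: EZ.
  rewrite sumEFin lee_fin (le_trans (sum_inv_square_le _ _))//.
  by rewrite gerBl.
have mZ k : measurable_fun [set: T] (Z k).
  apply: measurable_funX; apply: measurable_funB => //.
  exact: measurable_funM.
have := cvg0_of_summable_expectations mZ Z0 sZ; apply: filterS => w Zw.
apply: (cvg_ratio_of_square_passage m0 m_step m_mono
  (m_infty := m_infty)) => //.
apply/cvgrPdist_lt => e e0.
have /cvgr0Pnorm_lt/(_ (e ^+ 2)%R) := Zw; rewrite exprn_gt0// => /(_ isT).
apply: filterS => k; rewrite /Z normrX ltr_sqr ?nnegrE ?(ltW e0)//.
by rewrite distrC.
Qed.
End monotone_process.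
End strong_law.

(** * Paths of the number of distinct values *)

Section num_distinct_paths.
Context (R : realType) (T : Type) (E : choiceType) (x : nat -> T -> E).

Lemma num_distinct_ge0 n w : 0 <= num_distinct R x n w.
Proof. by rewrite /num_distinct. Qed.

Lemma num_distinct0 w : num_distinct R x 0 w = 0.
Proof. by rewrite /num_distinct II0 image_set0 fset_set0 cardfs0. Qed.

Lemma num_distinct_mono w : nondecreasing_seq ((num_distinct R x)^~ w).
Proof.
move=> i j ij; rewrite /num_distinct ler_nat fsubset_leq_card//.
rewrite -fset_set_sub//; [|exact: finite_image|exact: finite_image].
by move=> _ [k ki <-]; exists k => //; exact: leq_trans ki ij.
Qed.

Lemma num_distinct_step n w :
  num_distinct R x n.+1 w <= num_distinct R x n w + 1.
Proof.
rewrite /num_distinct natr1 ler_nat.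
have -> : [set x k w | k in `I_n.+1] = x n w |` [set x k w | k in `I_n].
  by rewrite IIS image_setU image_set1 setUC.
rewrite fset_setU1; last exact: finite_image.
by rewrite cardfsU1 -add1n leq_add2r; case: (_ \notin _).
Qed.

Lemma num_distinct_le n w : num_distinct R x n w <= n%:R.
Proof.
elim: n => [|n ih]; first by rewrite num_distinct0.
by rewrite (le_trans (num_distinct_step n w))// -natr1 lerD2r.
Qed.

End num_distinct_paths.

(** * Hitting events of an i.i.d. sequence *)

Section events.
Local Open Scope ereal_scope.
Context d (T : measurableType d) (R : realType) (P : probability T R).

(** The covariance of two events is that of their complements. *)
Lemma negatively_correlated_setC (A B : set T) :
  measurable A -> measurable B ->
  P (~` A `&` ~` B) <= P (~` A) * P (~` B) -> P (A `&` B) <= P A * P B.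
Proof.
move=> mA mB; have mCA := measurableC mA; have mCB := measurableC mB.
have PAB : P (A `&` B) = 1 - (P (~` A) + P (~` B) - P (~` A `&` ~` B)).
  rewrite -measureUfinr//; last by rewrite ltey_eq fin_num_measure.
  by rewrite -setCI -probability_setC ?setCK//; apply/measurableC/measurableI.
have PA : P A = 1 - P (~` A) by rewrite -probability_setC// setCK.
have PB : P B = 1 - P (~` B) by rewrite -probability_setC// setCK.
rewrite PAB PA PB.
have fA : P (~` A) \is a fin_num by rewrite fin_num_measure.
have fB : P (~` B) \is a fin_num by rewrite fin_num_measure.
have fAB : P (~` A `&` ~` B) \is a fin_num.
  by rewrite fin_num_measure//; exact: measurableI.
rewrite -(fineK fA) -(fineK fB) -(fineK fAB) -!(EFinB, EFinD, EFinM) !lee_fin.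
lra.
Qed.

End events.

Section occupancy.
Local Open Scope ereal_scope.
Context d d' (T : measurableType d) (E : measurableType d') (R : realType).
Variables (P : probability T R) (pi : probability E R).
Variable xi : nat -> {RV P >-> E}.
Hypothesis iid_xi : iid xi pi.

Lemma iid_probability_all n (B : set E) : measurable B ->
  P (\bigcap_(k in `I_n) xi k @^-1` B) = ((fine (pi B)) ^+ n)%:E.
Proof.
move=> mB; case: iid_xi => indep law.
have := indep (fset_set `I_n) (fun=> B) (fun _ _ => mB).
rewrite fset_setK//; move=> ->.
rewrite (eq_bigr (fun=> (fine (pi B))%:E)); last first.
  by move=> i _; rewrite fineK ?fin_num_measure// -(law i).
rewrite prodEFin big_const_seq count_predT iter_mulr_1 (@card_fset_set _ _ n)//.
Qed.

Definition hit n (x : E) : set T := \bigcup_(k in `I_n) xi k @^-1` [set x].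

Lemma setC_hit n x : ~` hit n x = \bigcap_(k in `I_n) xi k @^-1` (~` [set x]).
Proof. by rewrite setC_bigcup. Qed.

Lemma measurable_hit n x : measurable [set x] -> measurable (hit n x).
Proof.
move=> mx; apply: bigcup_measurable => k _.
by rewrite -[X in measurable X]setTI; exact: measurable_funP.
Qed.

Lemma probability_setC_hit n x : measurable [set x] ->
  P (~` hit n x) = ((1 - fine (pi [set x])) ^+ n)%:E.
Proof.
move=> mx; rewrite setC_hit iid_probability_all//; last exact: measurableC.
by rewrite probability_setC// fineB ?fin_num_measure.
Qed.

Lemma probability_hit n x : measurable [set x] ->
  P (hit n x) = (1 - (1 - fine (pi [set x])) ^+ n)%:E.
Proof.
move=> mx; have mh := measurable_hit n mx.
rewrite -[hit n x]setCK probability_setC ?probability_setC_hit//.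
exact: measurableC.
Qed.

(** Joint avoidance of [x] and [y] has probability [(1 - p - q)^n] for the
    masses [p] and [q] of [x] and [y], and [1 - p - q <= (1 - p) (1 - q)]. *)
Lemma hit_negatively_correlated n x y :
  measurable [set x] -> measurable [set y] -> x != y ->
  P (hit n x `&` hit n y) <= P (hit n x) * P (hit n y).
Proof.
move=> mx my xy; apply: negatively_correlated_setC;
  rewrite ?probability_setC_hit//.
- exact: measurable_hit.
- exact: measurable_hit.
have -> : ~` hit n x `&` ~` hit n y =
    \bigcap_(k in `I_n) xi k @^-1` (~` ([set x] `|` [set y])).
  by rewrite !setC_hit -bigcapI; apply: eq_bigcapr => k _; rewrite setCU.
have mxy : measurable ([set x] `|` [set y]) by exact: measurableU.
rewrite iid_probability_all; last exact: measurableC.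
rewrite -EFinM lee_fin -exprMn lerXn2r ?nnegrE//.
- by rewrite fine_ge0.
- rewrite mulr_ge0// subr_ge0 -lee_fin fineK ?fin_num_measure//;
    exact: probability_le1.
have -> : fine (pi (~` ([set x] `|` [set y]))) =
    (1 - (fine (pi [set x]) + fine (pi [set y])))%R.
  rewrite probability_setC// measureU//.
    by rewrite fineB ?fineD ?fin_numD ?fin_num_measure.
  by apply/seteqP; split => // z [/= -> yx]; rewrite yx eqxx in xy.
have := fine_ge0 (measure_ge0 pi [set x]).
have := fine_ge0 (measure_ge0 pi [set y]).
by move=> *; nra.
Qed.

(** * Moments of the number of distinct values *)

Section atoms.
Variable A : set E.
Hypothesis pi_A : supported_on_atoms pi A.
Variable a : nat -> E.
Hypothesis bij_a : set_bij [set: nat] A a.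

Lemma atom_in i : A (a i).
Proof. by case: bij_a => fa _ _; exact: fa. Qed.

Lemma measurable_atom i : measurable [set a i].
Proof. exact: (atom_measurable pi_A (atom_in i)). Qed.

Lemma measurable_support : measurable A.
Proof.
have -> : A = \bigcup_i [set a i].
  apply/seteqP; split => [x Ax|x [i _ ->]]; last exact: atom_in.
  by case: bij_a => _ _ sa; have [i _ <-] := sa x Ax; exists i.
by apply: bigcup_measurable => i _; exact: measurable_atom.
Qed.

Definition off_atoms : set T := \bigcup_k xi k @^-1` (~` A).

Lemma measurable_off_atoms : measurable off_atoms.
Proof.
apply: bigcup_measurable => k _; rewrite -[X in measurable X]setTI.
by apply: measurable_funP => //; exact/measurableC/measurable_support.
Qed.

Lemma probability_off_atoms : P off_atoms = 0.
Proof.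
have mCA := measurableC measurable_support.
apply/negligibleP; first exact: measurable_off_atoms.
apply: negligible_bigcup => k; apply/negligibleP.
  by rewrite -[X in measurable X]setTI; exact: measurable_funP.
have [_ /(_ k _ mCA) law] := iid_xi; transitivity (pi (~` A)); first exact: law.
rewrite probability_setC ?(atoms_full_mass pi_A) ?subee//.
exact: measurable_support.
Qed.

(** As an extended real series of indicators, this is measurable on the whole
    space, including where some variable is not an atom. *)
Definition hits n w : \bar R := \sum_(i <oo) (\1_(hit n (a i)) w)%:E.

Lemma num_distinct_hits n w : ~ off_atoms w ->
  (num_distinct R xi n w)%:E = hits n w.
Proof.
move=> onw; have xiA k : A (xi k w).
  by apply: contrapT => nA; apply: onw; exists k.
rewrite /hits nneseries_esumT; last by move=> i; rewrite lee_fin.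
rewrite -(reindex_esum _ _ a (fun x => (\1_(hit n x) w)%:E) bij_a).
rewrite /num_distinct; set S := [set xi k w | k in `I_n].
have SA : S `<=` A by move=> _ [k _ <-].
have finS : finite_set S by exact: finite_image.
transitivity (\esum_(x in A `&` S) (1 : \bar R)).
  rewrite (setIidr SA) esum_fset// fsbig_finite//= sumEFin.
  by rewrite big_const_seq count_predT iter_addr_0.
rewrite esum_mkcondr; apply: eq_esum => x Ax; rewrite indicE.
have -> : (w \in hit n x) = (x \in S).
  by apply/idP/idP; rewrite !inE => -[k kn kx]; exists k.
by case: (x \in S).
Qed.

Lemma measurable_hits n : measurable_fun [set: T] (hits n).
Proof.
apply: ge0_emeasurable_sum => [i w _ _|i _]; first by rewrite lee_fin.
by apply/measurable_EFinP/measurable_indic/measurable_hit/measurable_atom.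
Qed.

Lemma hits_ge0 n w : 0 <= hits n w.
Proof. by apply: nneseries_ge0 => i _ _; rewrite lee_fin. Qed.

Lemma integral_num_distinct n :
  \int[P]_w (num_distinct R xi n w)%:E = \int[P]_w hits n w.
Proof.
apply: (ge0_eq_integral_null measurable_off_atoms probability_off_atoms).
- by move=> w; rewrite lee_fin num_distinct_ge0.
- exact: hits_ge0.
- exact: num_distinct_hits.
Qed.

Lemma integral_hits n : \int[P]_w hits n w = \sum_(i <oo) P (hit n (a i)).
Proof.
have mhit i : measurable (hit n (a i)) by apply/measurable_hit/measurable_atom.
rewrite /hits integral_nneseries//.
  by apply: eq_eseriesr => i _; rewrite integral_indic ?setIT.
by move=> i; exact/measurable_EFinP/measurable_indic.
Qed.

Lemma num_distinct_sqr_hits n w : ~ off_atoms w ->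
  (num_distinct R xi n w ^+ 2)%:E =
  \sum_(i <oo) \sum_(j <oo) (\1_(hit n (a i) `&` hit n (a j)) w)%:E.
Proof.
move=> onw; rewrite expr2 EFinM {2}(num_distinct_hits _ onw).
rewrite -nneseriesZl; last first.
  by move=> i _; rewrite lee_fin.
apply: eq_eseriesr => i _; rewrite muleC (num_distinct_hits _ onw).
rewrite -nneseriesZl; last first.
  by move=> j _; rewrite lee_fin.
by apply: eq_eseriesr => j _; rewrite -EFinM indicI.
Qed.

Lemma integral_num_distinct_sqr n :
  \int[P]_w (num_distinct R xi n w ^+ 2)%:E =
  \sum_(i <oo) \sum_(j <oo) P (hit n (a i) `&` hit n (a j)).
Proof.
have mhit i : measurable (hit n (a i)) by apply/measurable_hit/measurable_atom.
have mI i j : measurable_fun [set: T]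
    (fun w => (\1_(hit n (a i) `&` hit n (a j)) w : R)%:E).
  by apply/measurable_EFinP/measurable_indic/measurableI.
transitivity (\int[P]_w
    \sum_(i <oo) \sum_(j <oo) (\1_(hit n (a i) `&` hit n (a j)) w : R)%:E).
  apply: (ge0_eq_integral_null measurable_off_atoms probability_off_atoms).
  - by move=> w; rewrite lee_fin sqr_ge0.
  - by move=> w; do 2 (apply: nneseries_ge0 => ? _ _); rewrite lee_fin.
  - exact: num_distinct_sqr_hits.
rewrite integral_nneseries//; first last.
- by move=> i w _; apply: nneseries_ge0 => j _ _; rewrite lee_fin.
- by move=> i; apply: ge0_emeasurable_sum => // j w _ _; rewrite lee_fin.
apply: eq_eseriesr => i _; rewrite integral_nneseries//.
apply: eq_eseriesr => j _; rewrite integral_indic ?setIT//.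
exact: measurableI.
Qed.

(** In the double series of [integral_num_distinct_sqr], negative correlation
    bounds the terms off the diagonal by those of [S * S]; the diagonal adds up
    to [S]. *)
Lemma integral_num_distinct_sqr_le n :
  let S := \sum_(i <oo) P (hit n (a i)) in
  S \is a fin_num ->
  \int[P]_w (num_distinct R xi n w ^+ 2)%:E <= S * S + S.
Proof.
move=> S finS; rewrite integral_num_distinct_sqr.
have S0 : 0 <= S by exact: nneseries_ge0.
have row i : \sum_(j <oo) P (hit n (a i) `&` hit n (a j)) <=
    S * P (hit n (a i)) + P (hit n (a i)).
  apply: (@le_trans _ _ (\sum_(j <oo) (P (hit n (a i)) * P (hit n (a j)) +
      (if j == i then P (hit n (a i)) else 0)))).
    apply: lee_nneseries => // j _; case: eqVneq => [->|ji].
      by rewrite setIid leeDr// mule_ge0.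
    rewrite adde0; apply: hit_negatively_correlated; try exact: measurable_atom.
    apply: contra ji => /eqP; case: bij_a => _ ia _.
    by move=> /(ia _ _ (mem_set Logic.I) (mem_set Logic.I)) ->.
  rewrite nneseriesD//; first last.
  - by move=> j _ _; case: ifP.
  - by move=> j _ _; rewrite mule_ge0.
  have fi : P (hit n (a i)) \is a fin_num.
    by rewrite fin_num_measure//; exact/measurable_hit/measurable_atom.
  rewrite -(fineK fi) nneseriesZl// (fineK fi) muleC; apply: leeD => //.
  rewrite (nneseriesD1 (n := i))//; last by move=> j _; case: ifP.
  by rewrite eqxx eseries0 ?adde0// => j _ /= /negPf ->.
apply: (@le_trans _ _ (\sum_(i <oo) (S * P (hit n (a i)) + P (hit n (a i))))).
  by apply: lee_nneseries => // i _; rewrite nneseries_ge0.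
rewrite nneseriesD//; last by move=> i _ _; rewrite mule_ge0.
by rewrite -{1}(fineK finS) nneseriesZl// fineK.
Qed.

Lemma expectation_num_distinct n :
  'E_P[num_distinct R xi n] = \sum_(i <oo) P (hit n (a i)).
Proof. by rewrite unlock integral_num_distinct integral_hits. Qed.

Lemma expectation_num_distinct_fin_num n :
  'E_P[num_distinct R xi n] \is a fin_num.
Proof.
rewrite ge0_fin_numE; last by apply: expectation_ge0; exact: num_distinct_ge0.
apply: (@le_lt_trans _ _ n%:R%:E); last exact: ltry.
rewrite unlock -[leRHS]mule1 -(probability_setT P) -integral_cst//.
apply: (ge0_le_integral_null measurable0 (measure0 P)) => w *.
- by rewrite lee_fin num_distinct_ge0.
- by rewrite lee_fin.
- by rewrite lee_fin num_distinct_le.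
Qed.

(** A measurable, real-valued and everywhere monotone version of the number of
    distinct values. *)
Definition on_atoms_count n w : R :=
  (num_distinct R xi n w * \1_(~` off_atoms) w)%R.

Lemma on_atoms_countE n w : ~ off_atoms w ->
  on_atoms_count n w = num_distinct R xi n w.
Proof. by move=> onw; rewrite /on_atoms_count indicE mem_set// mulr1. Qed.

Lemma on_atoms_count_ge0 n w : (0 <= on_atoms_count n w)%R.
Proof. by rewrite mulr_ge0// num_distinct_ge0. Qed.

Lemma on_atoms_count_le n w : (on_atoms_count n w <= n%:R)%R.
Proof.
rewrite /on_atoms_count indicE; case: (w \in _); rewrite ?mulr1 ?mulr0//.
exact: num_distinct_le.
Qed.

Lemma measurable_on_atoms_count n : measurable_fun [set: T] (on_atoms_count n).
Proof.
apply/measurable_EFinP.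
have -> : EFin \o on_atoms_count n =
    (fun w => hits n w * (\1_(~` off_atoms) w)%:E).
  apply/funext => w /=; rewrite /on_atoms_count.
  have [ow|onw] := pselect (off_atoms w).
    by rewrite indicE memNset ?mulr0 ?mule0//; exact.
  by rewrite EFinM num_distinct_hits.
apply: emeasurable_funM; first exact: measurable_hits.
by apply/measurable_EFinP/measurable_indic/measurableC/measurable_off_atoms.
Qed.

Lemma on_atoms_count_Lfun1 n : on_atoms_count n \in Lfun P 1.
Proof.
apply/Lfun1_integrable/measurable_bounded_integrable => //.
- by rewrite (le_lt_trans (probability_le1 P measurableT))// ltry.
- exact: measurable_on_atoms_count.
- exists n%:R; split => // M nM w _ /=.
  rewrite ger0_norm ?on_atoms_count_ge0//.
  by rewrite (le_trans (on_atoms_count_le n w))// ltW.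
Qed.

Lemma on_atoms_count_sqr_Lfun1 n :
  (on_atoms_count n * on_atoms_count n)%R \in Lfun P 1.
Proof.
apply/Lfun1_integrable/measurable_bounded_integrable => //.
- by rewrite (le_lt_trans (probability_le1 P measurableT))// ltry.
- by apply: measurable_funM; exact: measurable_on_atoms_count.
- exists (n%:R * n%:R)%R; split => // M nM w _ /=.
  have X0 := on_atoms_count_ge0 n w.
  rewrite ger0_norm ?mulr_ge0// (le_trans _ (ltW nM))//.
  by rewrite ler_pM// on_atoms_count_le.
Qed.

Lemma expectation_on_atoms_count n :
  'E_P[on_atoms_count n] = 'E_P[num_distinct R xi n].
Proof.
apply: (ge0_eq_expectation_null measurable_off_atoms probability_off_atoms).
- exact: on_atoms_count_ge0.
- exact: num_distinct_ge0.
- exact: on_atoms_countE.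
Qed.

Lemma variance_on_atoms_count n :
  'V_P[on_atoms_count n] = 'V_P[num_distinct R xi n].
Proof.
apply: (ge0_eq_variance_null measurable_off_atoms probability_off_atoms).
- exact: on_atoms_count_ge0.
- exact: num_distinct_ge0.
- exact: on_atoms_countE.
Qed.

Lemma variance_num_distinct_le n :
  'V_P[num_distinct R xi n] <= 'E_P[num_distinct R xi n].
Proof.
rewrite -variance_on_atoms_count /variance covarianceE; first last.
- exact: on_atoms_count_sqr_Lfun1.
- exact: on_atoms_count_Lfun1.
- exact: on_atoms_count_Lfun1.
rewrite expectation_on_atoms_count.
have -> : 'E_P[on_atoms_count n * on_atoms_count n] =
    \int[P]_w (num_distinct R xi n w ^+ 2)%:E.
  rewrite unlock.
  apply: (ge0_eq_integral_null measurable_off_atoms probability_off_atoms).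
  - by move=> w; rewrite lee_fin mulr_ge0 ?on_atoms_count_ge0.
  - by move=> w; rewrite lee_fin sqr_ge0.
  - by move=> w onw; rewrite fctE on_atoms_countE.
have fE := expectation_num_distinct_fin_num n.
rewrite leeBlDr ?fin_numM// addeC expectation_num_distinct.
apply: integral_num_distinct_sqr_le; rewrite -expectation_num_distinct//.
Qed.

Lemma esum_expectation_num_distinct n : 'E_P[num_distinct R xi n] =
  \esum_(x in A) (1 - (1 - fine (pi [set x])) ^+ n)%R%:E.
Proof.
rewrite (reindex_esum _ _ a _ bij_a) -nneseries_esumT.
  rewrite expectation_num_distinct; apply: eq_eseriesr => i _.
  by rewrite probability_hit//; exact: measurable_atom.
by move=> i; rewrite -probability_hit//; exact: measurable_atom.
Qed.

(** Each of the first [k] atoms is hit with probability tending to 1, so the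
    mean eventually exceeds every real below [k]; and there are infinitely many
    atoms. *)
Lemma expectation_num_distinct_cvgy :
  fine 'E_P[num_distinct R xi n] @[n --> \oo] --> +oo%R.
Proof.
apply/cvgryPge => c.
pose K := (Num.truncn c).+1.
pose p i := fine (pi [set a i]).
have p0 i : (0 < p i)%R.
  rewrite fine_gt0// (atom_mass_gt0 pi_A (atom_in i))/=.
  by rewrite ltey_eq fin_num_measure//; exact: measurable_atom.
have p1 i : (p i <= 1)%R.
  rewrite -lee_fin fineK ?fin_num_measure ?probability_le1//;
    exact: measurable_atom.
have hit_all k : (\sum_(0 <= i < k) (1 - (1 - p i) ^+ n))%R @[n --> \oo] -->
    (k%:R : R)%R.
  elim: k => [|k ih].
    by under eq_fun do rewrite big_geq//; exact: cvg_cst.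
  under eq_fun do rewrite big_nat_recr//=.
  rewrite -natr1; apply: cvgD => //; rewrite -[1%R in X in _ --> X]subr0.
  apply: cvgB; first exact: cvg_cst.
  by apply: cvg_expr; rewrite ger0_norm ?subr_ge0// ltrBlDr ltrDl.
have := hit_all K.
move=> /cvgr_ge /(_ c); have cK : (c < K%:R)%R by exact: truncnS_gt.
move=> /(_ cK); apply: filterS => n /le_trans; apply.
rewrite -lee_fin fineK ?expectation_num_distinct_fin_num//.
rewrite expectation_num_distinct.
apply: le_trans (nneseries_lim_ge K _) => //.
rewrite -sumEFin; apply: lee_sum => i _; rewrite probability_hit//.
exact: measurable_atom.
Qed.

Lemma expectation_num_distinct_step n :
  (fine 'E_P[num_distinct R xi n.+1] <= fine 'E_P[num_distinct R xi n] + 1)%R.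
Proof.
rewrite -lee_fin EFinD !fineK ?expectation_num_distinct_fin_num//.
rewrite -!expectation_on_atoms_count -(expectation_cst P 1) -expectationD.
- apply: expectation_le.
  + exact: measurable_on_atoms_count.
  + apply: measurable_funD => //; exact: measurable_on_atoms_count.
  + exact: on_atoms_count_ge0.
  + by move=> w; rewrite addr_ge0// on_atoms_count_ge0.
  + apply: aeW => w; rewrite /= /on_atoms_count indicE; case: (w \in _) => /=.
      by rewrite !mulr1 num_distinct_step.
    by rewrite !mulr0 add0r.
- exact: on_atoms_count_Lfun1.
- exact: Lfun_cst.
Qed.

Lemma strong_law_num_distinct : {ae P, forall w,
  (num_distinct R xi n w / fine 'E_P[num_distinct R xi n])%R @[n --> \oo] -->
    (1 : R)%R}.
Proof.
pose m n := fine 'E_P[num_distinct R xi n].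
have SL : {ae P, forall w,
    (on_atoms_count n w / m n)%R @[n --> \oo] --> (1 : R)%R}.
  apply: strong_law_of_variance_le_mean.
  - exact: measurable_on_atoms_count.
  - exact: on_atoms_count_ge0.
  - by move=> w i j ij; rewrite ler_wpM2r// num_distinct_mono.
  - move=> n; rewrite expectation_on_atoms_count fineK//.
    exact: expectation_num_distinct_fin_num.
  - move=> n; rewrite variance_on_atoms_count expectation_on_atoms_count.
    exact: variance_num_distinct_le.
  - rewrite /m (_ : num_distinct R xi 0 = cst 0%R) ?expectation_cst//.
    by apply/funext => w; exact: num_distinct0.
  - exact: expectation_num_distinct_step.
  - exact: expectation_num_distinct_cvgy.
have onA : {ae P, forall w, ~ off_atoms w}.
  exists off_atoms; split.
  - exact: measurable_off_atoms.
  - exact: probability_off_atoms.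
  - by move=> w /contrapT.
apply: filterS2 SL onA => w Xw onw.
by under eq_fun do rewrite -on_atoms_countE//.
Qed.

End atoms.
End occupancy.

Theorem theorem2 (R : realType) (d d' : measure_display)
    (T : measurableType d) (E : measurableType d')
    (P : probability T R) (pi : probability E R) (A : set E)
    (countable_A : countable A) (infinite_A : infinite_set A)
    (pi_A : supported_on_atoms pi A)
    (xi : nat -> {RV P >-> E}) (iid_xi : iid xi pi) :
  let Rn : nat -> T -> R := num_distinct R xi in
  {ae P, forall w, (fun n => Rn n w / fine ('E_P[Rn n])%E) @ \oo --> (1 : R)} /\
  (forall n : nat, (0 < n)%N ->
    ('E_P[Rn n] = \esum_(x in A) (1 - (1 - fine (pi [set x])) ^+ n)%R%:E)%E /\
    ('V_P[Rn n] <= 'E_P[Rn n])%E).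
Proof.
have /card_esym/card_set_bijP[a bij_a] := eq_card_nat countable_A infinite_A.
split; first exact: (strong_law_num_distinct iid_xi pi_A bij_a).
move=> n _; split.
  exact: (esum_expectation_num_distinct iid_xi pi_A bij_a).
exact: (variance_num_distinct_le iid_xi pi_A bij_a).
Qed.
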